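(* Let $X$ be a proper submodule of $M$. Then the following are equivalent: (1) $X$ is a $\phi$-prime submodule of $M$. (2) For every ideal $I$ of $R$ with $I\nsubseteq(X:_{R}M)$, $(X:_{M}I)=X\cup(\phi(X):_{M}I)$. (3) For every ideal $I$ of $R$ with $I\nsubseteq(X:_{R}M)$, $(X:_{M}I)=X$ or $(X:_{M}I)=(\phi(X):_{M}I)$.
   Context: $R$ is an associative ring with identity, not necessarily commutative, and $M$ is a unitary right $R$-module. $S(M)$ is the set of all submodules of $M$; ''ideal'' means two-sided ideal. For a submodule $Y$ of $M$ and $I\subseteq R$, $YI$ is the set of finite sums of elements $yr$ with $y\in Y$, $r\in I$. $(X:_{R}M)=\{r\in R: Mr\subseteq X\}$, and for an ideal $I$ of $R$, $(X:_{M}I)=\{t\in M: tI\subseteq X\}$ (also used with $X$ replaced by $\emptyset$). A function $\phi:S(M)\to S(M)\cup\{\emptyset\}$ is fixed, with the standing convention that $\phi(X)\subseteq X$ for every $X\in S(M)$. A proper submodule $X$ of $M$ is $\phi$-prime if for every $Y\in S(M)$ and every ideal $I$ of $R$, $YI\subseteq X$ and $YI\nsubseteq\phi(X)$ imply $Y\subseteq X$ or $I\subseteq(X:_{R}M)$. *)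

(* Defs.v *)
(* MathComp, with sets in the sense of mathcomp-classical. *)
From mathcomp Require Import all_boot all_algebra.
From mathcomp Require Import boolp classical_sets.

Set Implicit Arguments.
Unset Strict Implicit.
Unset Printing Implicit Defensive.

Import GRing.Theory.
Local Open Scope classical_set_scope.
Local Open Scope ring_scope.

(* MathComp only has left modules; a right [R]-module is a left module over the
   converse ring [R^c], and [ract x r] is the element written [x r]. *)
Definition ract (R : pzRingType) (M : lmodType R^c) (x : M) (r : R) : M :=
  (r : R^c) *: x.

Definition is_submodule (R : pzRingType) (M : lmodType R^c) (X : set M) : Prop :=
  GRing.submod_closed [in X].

Record submodule (R : pzRingType) (M : lmodType R^c) := Submodule {
  submodule_set :> set M;
  submodule_setP : is_submodule submodule_set
}.

(* [idealr_closed] of ring_quotient is one-sided and excludes the unit ideal. *)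
Definition is_ideal (R : pzRingType) (I : set R) : Prop :=
  GRing.zmod_closed [in I] /\
  forall a r : R, I a -> I (r * a) /\ I (a * r).

Definition set_ract (R : pzRingType) (M : lmodType R^c)
    (Y : set M) (I : set R) : set M :=
  [set t | exists n (y : 'I_n -> M) (r : 'I_n -> R),
     [/\ forall i, Y (y i), forall i, I (r i) & t = \sum_(i < n) ract (y i) (r i)]].

(* [(X :_R M)] *)
Definition colon_ring (R : pzRingType) (M : lmodType R^c) (X : set M) : set R :=
  [set r | [set ract m r | m in [set: M]] `<=` X].

(* [(X :_M I)]; the set [X] may be empty. *)
Definition colon_mod (R : pzRingType) (M : lmodType R^c)
    (X : set M) (I : set R) : set M :=
  [set t | [set ract t r | r in I] `<=` X].

Definition phi_prime (R : pzRingType) (M : lmodType R^c)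
    (phi : submodule M -> set M) (X : submodule M) : Prop :=
  (X : set M) <> setT /\
  forall (Y : submodule M) (I : set R), is_ideal I ->
    set_ract Y I `<=` X -> ~ (set_ract Y I `<=` phi X) ->
    Y `<=` X \/ I `<=` colon_ring X.

(* Main.v *)
Require Import Defs.
From mathcomp Require Import all_boot all_algebra.
From mathcomp Require Import boolp classical_sets.

(** Two observations carry the proof.

    First, [Y I] is contained in [N] exactly when [Y] is contained in [(N : I)]
    ([set_ract_sub] and [sub_colon_mod]), so being [phi]-prime can be read off
    from the residuals [(X : I)] and [(phi X : I)], for [I] not contained in
    [(X : M)].  An element [t] of [(X : I)] outside [X] is tested with [Y = t R]
    ([phi_prime_colon_mod]): since [I] absorbs [R], [t R I] lies in [X], so
    primeness pushes it into [phi X].  Conversely, if [Y I] lies in [X] but not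
    in [phi X], then [Y] lies in [(X : I)] but not in [(phi X : I)]; when
    [(X : I)] is one of [X] and [(phi X : I)], it must be [X], which therefore
    contains [Y].

    Secondly, an additive group is never the union of two proper subgroups
    ([setU_closedB_eq]); this turns the equation [(X : I) = X `|` (phi X : I)]
    into an alternative.

    The possible value [set0] of [phi X] fits in the same scheme because an
    ideal contains [0]: then [(phi X : I)] is empty, and [Y I], which contains
    the empty sum, is not contained in [phi X]. *)

Import GRing.Theory.
Local Open Scope classical_set_scope.
Local Open Scope ring_scope.

Section Residuals.
Set Implicit Arguments. Unset Strict Implicit.
Variables (R : pzRingType) (M : lmodType R^c).
Implicit Types (N Y : set M) (I : set R) (t u : M) (r s : R).

Lemma ractA t r s : ract (ract t r) s = ract t (r * s).
Proof. by rewrite /ract scalerA. Qed.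

Lemma submodule0 N : is_submodule N -> N 0.
Proof. by case=> N0 _; move: N0; rewrite inE. Qed.

Lemma submoduleD N t u : is_submodule N -> N t -> N u -> N (t + u).
Proof.
case=> _ Nlin Nt Nu; have := Nlin 1 t u; rewrite scale1r !inE.
exact.
Qed.

Lemma submodule_ract N t r : is_submodule N -> N t -> N (ract t r).
Proof.
move=> Nsub Nt; have N0 := submodule0 Nsub; case: Nsub => _ Nlin.
by have := Nlin (r : R^c) t 0; rewrite addr0 !inE; apply.
Qed.

Lemma submoduleB N t u : is_submodule N -> N t -> N u -> N (t - u).
Proof.
move=> Nsub Nt Nu; apply: submoduleD => //.
by rewrite -scaleN1r; apply: (submodule_ract (-1)).
Qed.

Lemma ideal0 I : is_ideal I -> I 0.
Proof. by case=> -[I0 _] _; move: I0; rewrite inE. Qed.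

Lemma cyclic_is_submodule t : is_submodule (range (ract t)).
Proof.
split=> [|a u v]; rewrite !inE; first by exists 0; rewrite // /ract scale0r.
move=> [r _ <-] [s _ <-]; exists (r * (a : R) + s) => //.
by rewrite /ract scalerDl scalerA.
Qed.

Definition cyclic_submodule t : submodule M :=
  Submodule (cyclic_is_submodule t).

Lemma mem_cyclic t : range (ract t) t.
Proof. by exists 1; rewrite // /ract scale1r. Qed.

Lemma sub_colon_mod N Y I : set_ract Y I `<=` N -> Y `<=` colon_mod N I.
Proof.
move=> YIN t Yt _ [r Ir <-]; apply: YIN.
by exists 1%N, (fun=> t), (fun=> r); split; rewrite // big_ord1.
Qed.

(** For [N = set0] the inclusion [Y `<=` colon_mod N I] is absurd, because [Y]
    and [I] both have an element, namely [0]. *)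
Lemma set_ract_sub N Y I : is_submodule N \/ N = set0 -> Y 0 -> I 0 ->
  Y `<=` colon_mod N I -> set_ract Y I `<=` N.
Proof.
move=> [Nsub | ->] Y0 I0 YN; last first.
  by have [] : (set0 : set M) (ract 0 0) by apply: (YN 0) => //; exists 0.
move=> _ [n [y [r [Yy Ir ->]]]].
apply: (big_ind N) => [|u v|i _]; first exact: submodule0.
- exact: submoduleD.
- by apply: (YN (y i)) => //; exists (r i).
Qed.

Lemma colon_modB N I t u : is_submodule N \/ N = set0 ->
  colon_mod N I t -> colon_mod N I u -> colon_mod N I (t - u).
Proof.
move=> Nsub Nt Nu _ [r Ir <-].
have {}Nt : N (ract t r) by apply: Nt; exists r.
have {}Nu : N (ract u r) by apply: Nu; exists r.
have -> : ract (t - u) r = ract t r - ract u r by exact: scalerBr.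
by case: Nsub => [Nsub | N0]; [exact: submoduleB | rewrite N0 in Nt].
Qed.

Lemma colon_modS N N' I : N `<=` N' -> colon_mod N I `<=` colon_mod N' I.
Proof. by move=> NN' t Nt; apply: subset_trans NN'. Qed.

Lemma sub_colon_mod_self N I : is_submodule N -> N `<=` colon_mod N I.
Proof. by move=> Nsub t Nt _ [r _ <-]; apply: submodule_ract. Qed.

End Residuals.

(** An element of [C] outside [A] lies in [B], one outside [B] lies in [A], and
    their difference can lie in neither.  Closure under subtraction, rather than
    being a subgroup, is assumed so that empty sets are covered. *)
Lemma setU_closedB_eq (V : zmodType) (A B C : set V) :
    (forall x y, A x -> A y -> A (x - y)) ->
    (forall x y, B x -> B y -> B (x - y)) ->
    (forall x y, C x -> C y -> C (x - y)) ->
  C = A `|` B -> C = A \/ C = B.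
Proof.
move=> AB BB CB CE.
have [CA | /nonsubset [a [Ca Aa]]] := pselect (C `<=` A).
  by left; apply/seteqP; split=> // x Ax; rewrite CE; left.
have [CsB | /nonsubset [b [Cb Bb]]] := pselect (C `<=` B).
  by right; apply/seteqP; split=> // x Bx; rewrite CE; right.
have Ba : B a by move: Ca; rewrite CE => -[].
have Ab : A b by move: Cb; rewrite CE => -[].
have := CB _ _ Cb Ca; rewrite CE => -[Aba | Bba].
- by case: Aa; rewrite -(subKr b a); apply: AB.
- have Bna : B (- a) by rewrite -sub0r -(subrr a); apply: (BB) => //; apply: BB.
  by case: Bb; rewrite -(subrK a b) -[X in _ + X]opprK; apply: BB.
Qed.

(** Testing primeness on the cyclic submodule [t R] is legitimate because
    [t R I = t I]: the ideal [I] absorbs [R] on the left. *)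
Lemma phi_prime_colon_mod (R : pzRingType) (M : lmodType R^c)
    (phi : submodule M -> set M) (X : submodule M) (I : set R) :
    phi_prime phi X -> is_ideal I -> ~ (I `<=` colon_ring X) ->
  colon_mod X I `<=` X `|` colon_mod (phi X) I.
Proof.
move=> [_ Xprime] Iideal IX t tX.
have tR_X : range (ract t) `<=` colon_mod X I.
  move=> _ [s _ <-] _ [r Ir <-]; apply: tX; exists (s * r).
    by case: Iideal => _ /(_ r s Ir) [].
  by rewrite ractA.
have tRI_X : set_ract (range (ract t)) I `<=` X.
  apply: set_ract_sub => //.
  - by left; exact: submodule_setP.
  - exact: (submodule0 (cyclic_is_submodule t)).
  - exact: ideal0.
have [tRI_phi | tRI_phi] := pselect (set_ract (range (ract t)) I `<=` phi X).
  by right; exact: (sub_colon_mod tRI_phi (mem_cyclic t)).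
have [tR_sub | //] := Xprime (cyclic_submodule t) I Iideal tRI_X tRI_phi.
by left; exact: (tR_sub t (mem_cyclic t)).
Qed.

Theorem theorem7 (R : pzRingType) (M : lmodType R^c)
    (phi : submodule M -> set M)
    (phi_codom : forall N : submodule M, is_submodule (phi N) \/ phi N = set0)
    (phi_sub : forall N : submodule M, phi N `<=` N)
    (X : submodule M) (X_proper : (X : set M) <> setT) :
  [<-> phi_prime phi X;
       forall I : set R, is_ideal I -> ~ (I `<=` colon_ring X) ->
         colon_mod X I = X `|` colon_mod (phi X) I;
       forall I : set R, is_ideal I -> ~ (I `<=` colon_ring X) ->
         colon_mod X I = X \/ colon_mod X I = colon_mod (phi X) I].
Proof.
have Xsub : is_submodule X by exact: submodule_setP.
tfae.
- move=> Xprime I Iideal IX; apply/seteqP; split.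
    exact: phi_prime_colon_mod.
  by rewrite subUset; split; [exact: sub_colon_mod_self | exact: colon_modS].
- move=> XE I Iideal IX; apply: setU_closedB_eq (XE I Iideal IX) => t u.
  + exact: submoduleB.
  + exact: colon_modB.
  + by apply: colon_modB; left.
- move=> XE; split=> // Y I Iideal YI_X YI_phi.
  have [IX | IX] := pselect (I `<=` colon_ring X); [by right | left].
  have := sub_colon_mod YI_X; have [-> // | -> Y_phi] := XE I Iideal IX.
  case: YI_phi; apply: set_ract_sub => //.
  + by apply: submodule0; apply: submodule_setP.
  + exact: ideal0.
Qed.
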